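(* $V_6=\displaystyle\inf_{a\in[1.6456659,\,1.8231801]}\frac{\chi_6(a)}{(\sqrt a-1)^2}$.
   Context: For an integer $n\ge 2$, $C_n$ denotes the set of real cosine polynomials $f(\phi)=\sum_{k=0}^{n} a_k\cos(k\phi)$ such that (i) all coefficients are real and nonnegative, (ii) $a_1>a_0>0$, and (iii) $f(\phi)\ge 0$ for all real $\phi$. For $f\in C_n$, $v(f)=\dfrac{f(0)-a_0}{(\sqrt{a_1}-\sqrt{a_0})^2}$ and $V_n=\inf_{f\in C_n}v(f)$. For $a\in\left(1,2\cos\frac{\pi}{n+2}\right]$, $\chi_n(a)=\inf\{f(0)-1 : f\in C_n,\ a_0(f)=1,\ a_1(f)=a\}$, where $a_k(f)$ is the $k$-th cosine coefficient of $f$. Numerical constants are decimal values as given in the paper, to seven decimal places. *)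

(* Defs.v *)
From Stdlib Require Import Reals.
From Coquelicot Require Import Coquelicot.
Open Scope R_scope.

(* A cosine polynomial of degree at most n is represented by its sequence of
   cosine coefficients, extended by zero beyond n. This is a bijection, since
   the functions cos (k phi) are linearly independent. *)
Definition cospoly (n : nat) (a : nat -> R) (phi : R) : R :=
  sum_f_R0 (fun k => a k * cos (INR k * phi)) n.

Definition Cn (n : nat) (a : nat -> R) : Prop :=
  (forall k, (n < k)%nat -> a k = 0) /\
  (forall k, 0 <= a k) /\
  0 < a 0%nat < a 1%nat /\
  (forall phi, 0 <= cospoly n a phi).

Definition v (n : nat) (a : nat -> R) : R :=
  (cospoly n a 0 - a 0%nat) / (sqrt (a 1%nat) - sqrt (a 0%nat)) ^ 2.

(* The conversion from Rbar sends infinite bounds to 0. The sets used below are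
   bounded below by 0, and they are nonempty when n >= 2 (for chi, when moreover
   1 < a <= 2 cos (pi / (n + 2))), so their infima are finite. *)
Definition inf (E : R -> Prop) : R := real (Glb_Rbar E).

Definition V (n : nat) : R :=
  inf (fun y => exists f, Cn n f /\ y = v n f).

Definition chi (n : nat) (a : R) : R :=
  inf (fun y => exists f, Cn n f /\ f 0%nat = 1 /\ f 1%nat = a /\
                          y = cospoly n f 0 - 1).

(* Main.v *)
(** By homogeneity every [f] in [C_6] may be normalised to [a_0 = 1], so the
    claim is that the infimum defining [V_6] is not affected by the polynomials
    with [a = a_1] outside the interval.  The polynomial
    [(cos phi + 9/10)^2 (cos phi + 3/10)^2] has [a] inside it and [v <= 35],
    whereas outside [v >= 35].  The latter is linear programming duality: a
    nonnegative combination of values [f (phi_j) >= 0] whose [k]-th moment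
    [c_k] is at most 1 for all [k >= 2] yields
    [f 0 - 1 >= (1 - c_1) a - c_0]. *)
Require Import Defs.
From Stdlib Require Import Reals Lra Lia.
From Coquelicot Require Import Coquelicot.
Open Scope R_scope.

(** The bound [m] and the element [e] exclude the infinite values of [Glb_Rbar], which [real] would
    send to 0. *)
Lemma inf_spec (E : R -> Prop) (m e : R) :
  (forall y, E y -> m <= y) -> E e ->
  (forall y, E y -> inf E <= y) /\
  (forall b, (forall y, E y -> b <= y) -> b <= inf E).
Proof.
intros Hm He. unfold inf.
destruct (Glb_Rbar_correct E) as [Hlb Hglb].
assert (H1 : Rbar_le m (Glb_Rbar E)) by (apply Hglb; intros y Hy; exact (Hm y Hy)).
assert (H2 := Hlb e He).
destruct (Glb_Rbar E) as [g| |]; simpl in H1, H2 |- *; try contradiction.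
split.
- intros y Hy. exact (Hlb y Hy).
- intros b Hb. exact (Hglb (Finite b) Hb).
Qed.

(** * Cosine polynomials as polynomials in [cos phi] *)

Fixpoint chebyshev (k : nat) (x : R) : R :=
  match k with
  | O => 1
  | S k' => match k' with
            | O => x
            | S k'' => 2 * x * chebyshev k' x - chebyshev k'' x
            end
  end.

Lemma cos_INR_mult (k : nat) (phi : R) :
  cos (INR k * phi) = chebyshev k (cos phi).
Proof.
(* The recurrence has order two, so the induction carries two consecutive indices. *)
enough (H : cos (INR k * phi) = chebyshev k (cos phi) /\
            cos (INR (S k) * phi) = chebyshev (S k) (cos phi)) by apply H.
induction k as [|k [IH1 IH2]].
- simpl. now rewrite Rmult_0_l, Rmult_1_l, cos_0.
- split; [exact IH2|].
  change (chebyshev (S (S k)) (cos phi))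
    with (2 * cos phi * chebyshev (S k) (cos phi) - chebyshev k (cos phi)).
  rewrite <- IH1, <- IH2.
  replace (INR (S (S k)) * phi) with (INR (S k) * phi + phi)
    by (rewrite (S_INR (S k)); ring).
  replace (INR k * phi) with (INR (S k) * phi - phi) by (rewrite (S_INR k); ring).
  rewrite cos_plus, cos_minus. ring.
Qed.

Lemma cospoly_chebyshev (n : nat) (f : nat -> R) (phi : R) :
  cospoly n f phi = sum_f_R0 (fun k => f k * chebyshev k (cos phi)) n.
Proof. apply sum_eq. intros k _. now rewrite cos_INR_mult. Qed.

(** At a rational [x] this is a linear constraint on the coefficients, ready for [lra]. *)
Lemma Cn_chebyshev_nonneg (n : nat) (f : nat -> R) (x : R) :
  Cn n f -> -1 <= x <= 1 ->
  0 <= sum_f_R0 (fun k => f k * chebyshev k x) n.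
Proof.
intros (_ & _ & _ & Hf) Hx.
rewrite <- (cos_acos x Hx), <- cospoly_chebyshev. apply Hf.
Qed.

Lemma cospoly_at_0 (n : nat) (f : nat -> R) : cospoly n f 0 = sum_f_R0 f n.
Proof.
apply sum_eq. intros k _. now rewrite Rmult_0_r, cos_0, Rmult_1_r.
Qed.

(** * Homogeneity and positivity of [v] *)

Lemma cospoly_scale (n : nat) (f : nat -> R) (c phi : R) :
  cospoly n (fun k => c * f k) phi = c * cospoly n f phi.
Proof.
unfold cospoly. rewrite scal_sum. apply sum_eq. intros k _. ring.
Qed.

Lemma Cn_scale (n : nat) (f : nat -> R) (c : R) :
  0 < c -> Cn n f -> Cn n (fun k => c * f k).
Proof.
intros Hc (H0 & H1 & [H2 H3] & H4). repeat split.
- intros k Hk. rewrite (H0 k Hk). ring.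
- intros k. specialize (H1 k). nra.
- nra.
- nra.
- intros phi. rewrite cospoly_scale. specialize (H4 phi). nra.
Qed.

Lemma sqrt_sub_pos (x y : R) : 0 < x < y -> 0 < sqrt y - sqrt x.
Proof. intros H. assert (sqrt x < sqrt y) by (apply sqrt_lt_1; lra). lra. Qed.

Lemma v_scale (n : nat) (f : nat -> R) (c : R) :
  0 < c -> Cn n f -> v n (fun k => c * f k) = v n f.
Proof.
intros Hc (_ & _ & H & _). unfold v.
rewrite cospoly_scale, !sqrt_mult by lra.
assert (Hs := sqrt_sub_pos _ _ H).
assert (Hq : 0 < sqrt c) by (apply sqrt_lt_R0; lra).
replace ((sqrt c * sqrt (f 1%nat) - sqrt c * sqrt (f 0%nat)) ^ 2)
  with (sqrt c * sqrt c * (sqrt (f 1%nat) - sqrt (f 0%nat)) ^ 2) by ring.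
rewrite sqrt_sqrt by lra. field. split; lra.
Qed.

Lemma Cn_value_gap (n : nat) (f : nat -> R) : Cn n f -> 0 <= cospoly n f 0 - f 0%nat.
Proof.
intros (_ & H & _). rewrite cospoly_at_0.
induction n as [|n IH]; simpl; [|specialize (H (S n))]; lra.
Qed.

Lemma v_nonneg (n : nat) (f : nat -> R) : Cn n f -> 0 <= v n f.
Proof.
intros H. assert (H0 := Cn_value_gap n f H).
destruct H as (_ & _ & H & _). unfold v. apply Rdiv_le_0_compat; [exact H0|].
apply pow_lt, sqrt_sub_pos, H.
Qed.

Lemma V_le_v (n : nat) (f : nat -> R) : Cn n f -> V n <= v n f.
Proof.
intros Hf.
apply (inf_spec (fun y => exists f, Cn n f /\ y = v n f) 0 (v n f)).
- intros y (g & Hg & ->). now apply v_nonneg.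
- now exists f.
- now exists f.
Qed.

(** * Explicit members of [Cn 6] *)

Definition truncated (l : list R) (k : nat) : R := List.nth k l 0.

Lemma truncated_nonneg (l : list R) (k : nat) :
  List.Forall (fun x => 0 <= x) l -> 0 <= truncated l k.
Proof.
intros H. unfold truncated. revert k.
induction H as [|x l Hx _ IH]; intros [|k]; simpl; try lra. apply IH.
Qed.

(* A convex combination of 1 and
   [(5 + 10 cos phi + 8 cos (2 phi) + 4 cos (3 phi))^2 / 115]; the square has
   [a_1 / a_0 = 212 / 115], just below the maximum [2 cos (pi / 8)]. *)
Definition feasible (a : R) : nat -> R :=
  truncated (cons 1 (cons a (cons (a / 106 * 85) (cons (a / 106 * 60)
    (cons (a / 106 * 36) (cons (a / 106 * 16) (cons (a / 106 * 4) nil))))))).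

Lemma Cn_feasible (a : R) : 1 < a <= 1.8231801 -> Cn 6 (feasible a).
Proof.
intros Ha. repeat split.
- intros k Hk. unfold feasible, truncated. apply List.nth_overflow. simpl. lia.
- intros k. apply truncated_nonneg. repeat constructor; lra.
- unfold feasible, truncated. simpl. lra.
- unfold feasible, truncated. simpl. lra.
- intros phi. rewrite cospoly_chebyshev.
  unfold feasible, truncated. simpl. generalize (cos phi). intros x.
  (* With [q] this square, the polynomial is [(1 - 115 a / 212) + (a / 212) q], and
     [a < 212 / 115]. *)
  assert (H := pow2_ge_0 (5 + 10 * x + 8 * (2 * x * x - 1)
                          + 4 * (2 * x * (2 * x * x - 1) - x))).
  nra.
Qed.

(** The coefficients of [(cos phi + 9/10)^2 (cos phi + 3/10)^2]; here [a_1 / a_0] is about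
    1.7025. *)
Definition witness : nat -> R :=
  truncated (cons 1.4379 (cons 2.448 (cons 1.49 (cons 0.6 (cons 0.125 nil))))).

Lemma Cn_witness : Cn 6 witness.
Proof.
repeat split.
- intros k Hk. apply List.nth_overflow. simpl. lia.
- intros k. apply truncated_nonneg. repeat constructor; lra.
- unfold witness, truncated. simpl. lra.
- unfold witness, truncated. simpl. lra.
- intros phi. rewrite cospoly_chebyshev.
  unfold witness, truncated. simpl. generalize (cos phi). intros x.
  assert (H := pow2_ge_0 ((x + 0.9) * (x + 0.3))).
  nra.
Qed.

Lemma v_witness : v 6 witness <= 35.
Proof.
(* Both roots are rounded to four decimals in the unfavourable direction; what remains is
   [4.663 <= 35 (1.5646 - 1.1992)^2]. *)
assert (H1 : 1.5646 <= sqrt 2.448).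
{ rewrite <- (sqrt_pow2 1.5646) by lra. apply sqrt_le_1; lra. }
assert (H0 : sqrt 1.4379 <= 1.1992).
{ rewrite <- (sqrt_pow2 1.1992) by lra. apply sqrt_le_1; lra. }
unfold v. rewrite cospoly_at_0. unfold witness, truncated. simpl.
apply Rle_div_l; [apply Rlt_gt|]; nra.
Qed.

(** The polynomial [feasible a] makes the set nonempty, so [chi 6 a] is a genuine infimum. *)
Lemma chi_spec (a : R) : 1 < a <= 1.8231801 ->
  (forall f, Cn 6 f -> f 0%nat = 1 -> f 1%nat = a ->
     chi 6 a <= cospoly 6 f 0 - 1) /\
  (forall b, (forall f, Cn 6 f -> f 0%nat = 1 -> f 1%nat = a ->
     b <= cospoly 6 f 0 - 1) -> b <= chi 6 a).
Proof.
intros Ha.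
destruct (inf_spec (fun y => exists f, Cn 6 f /\ f 0%nat = 1 /\ f 1%nat = a /\
                                       y = cospoly 6 f 0 - 1)
                   0 (cospoly 6 (feasible a) 0 - 1)) as [H1 H2].
- intros y (f & Hf & Hf0 & _ & ->). rewrite <- Hf0. now apply Cn_value_gap.
- exists (feasible a). split; [now apply Cn_feasible|]. repeat split.
- split.
  + intros f Hf Hf0 Hf1. apply H1. exists f. repeat split; trivial; apply Hf.
  + intros b Hb. apply H2. intros y (f & Hf & Hf0 & Hf1 & ->). now apply Hb.
Qed.

(** * Lower bounds for [v] outside the interval *)

Lemma v_normalised (n : nat) (f : nat -> R) : f 0%nat = 1 ->
  v n f = (cospoly n f 0 - 1) / (sqrt (f 1%nat) - 1) ^ 2.
Proof. intros H. unfold v. now rewrite H, sqrt_1. Qed.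

Lemma sqrt_sub_1_pos (a : R) : 1 < a -> 0 < (sqrt a - 1) ^ 2.
Proof.
intros Ha. rewrite <- sqrt_1 at 1. apply pow_lt, sqrt_sub_pos. lra.
Qed.

(** The first bound follows from [f(pi) >= 0] alone. For the second, weights 1.1, 3, 2.9 at
    [cos phi] = -1, -9/10, -4/10 give [c_0 = 7], [c_1 = -4.96] and higher moments at most 1. *)
Lemma dual_bound_low (f : nat -> R) : Cn 6 f -> f 0%nat = 1 ->
  2 * f 1%nat - 1 <= cospoly 6 f 0 - 1 /\
  5.96 * f 1%nat - 7 <= cospoly 6 f 0 - 1.
Proof.
intros Hf Hf0. rewrite cospoly_at_0.
assert (E1 := Cn_chebyshev_nonneg 6 f (-1) Hf ltac:(lra)).
assert (E2 := Cn_chebyshev_nonneg 6 f (-9/10) Hf ltac:(lra)).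
assert (E3 := Cn_chebyshev_nonneg 6 f (-4/10) Hf ltac:(lra)).
destruct Hf as (_ & Hp & _).
assert (P2 := Hp 2%nat). assert (P3 := Hp 3%nat). assert (P4 := Hp 4%nat).
assert (P5 := Hp 5%nat). assert (P6 := Hp 6%nat).
simpl in *. rewrite Hf0 in *. split; lra.
Qed.

(** The same duality with [c_0 <= 60.7] and [c_1 = -34.66]; [lra] finds the weights at five points
    of the grid of step 1/30. *)
Lemma dual_bound_high (f : nat -> R) : Cn 6 f -> f 0%nat = 1 ->
  35.66 * f 1%nat - 60.7 <= cospoly 6 f 0 - 1.
Proof.
intros Hf Hf0. rewrite cospoly_at_0.
assert (E1 := Cn_chebyshev_nonneg 6 f (-28/30) Hf ltac:(lra)).
assert (E2 := Cn_chebyshev_nonneg 6 f (-27/30) Hf ltac:(lra)).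
assert (E3 := Cn_chebyshev_nonneg 6 f (-13/30) Hf ltac:(lra)).
assert (E4 := Cn_chebyshev_nonneg 6 f (-12/30) Hf ltac:(lra)).
assert (E5 := Cn_chebyshev_nonneg 6 f (9/30) Hf ltac:(lra)).
destruct Hf as (_ & Hp & _).
assert (P2 := Hp 2%nat). assert (P3 := Hp 3%nat). assert (P4 := Hp 4%nat).
assert (P5 := Hp 5%nat). assert (P6 := Hp 6%nat).
simpl in *. rewrite Hf0 in *. lra.
Qed.

Lemma v_outside (f : nat -> R) : Cn 6 f -> f 0%nat = 1 ->
  f 1%nat < 1.6456659 \/ 1.8231801 < f 1%nat -> 35 <= v 6 f.
Proof.
intros Hf Hf0 Ha.
assert (H1 : 1 < f 1%nat) by (rewrite <- Hf0; apply Hf).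
rewrite v_normalised by exact Hf0.
destruct (dual_bound_low f Hf Hf0) as [B1 B2].
assert (B3 := dual_bound_high f Hf Hf0).
revert H1 Ha B1 B2 B3. generalize (cospoly 6 f 0 - 1). generalize (f 1%nat).
intros a y H1 Ha B1 B2 B3.
apply Rle_div_r; [apply Rlt_gt, sqrt_sub_1_pos, H1|].
assert (Hs : sqrt a * sqrt a = a) by (apply sqrt_sqrt; lra).
assert (Hs1 : 1 < sqrt a) by (rewrite <- sqrt_1; apply sqrt_lt_1; lra).
(* With [a = s * s] only quadratic inequalities in [s] remain. *)
revert Hs Hs1. generalize (sqrt a). intros s Hs Hs1. subst a.
destruct Ha as [Ha|Ha].
(* 1.28284 slightly exceeds the root of 1.6456659. Up to [s = 1.244] the bound [2 a - 1] suffices,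
   beyond it [5.96 a - 7]. *)
- assert (s < 1.28284) by nra.
  destruct (Rle_or_lt s 1.244); nra.
(* 1.35025 is just below the root of 1.8231801, and [35.66 a - 60.7] suffices from there on. *)
- assert (1.35025 < s) by nra. nra.
Qed.

(** * Comparison of the two infima *)

Definition interval_ratios (y : R) : Prop :=
  exists a : R, 1.6456659 <= a <= 1.8231801 /\ y = chi 6 a / (sqrt a - 1) ^ 2.

Lemma interval_ratios_inf :
  (forall y, interval_ratios y -> inf interval_ratios <= y) /\
  (forall b, (forall y, interval_ratios y -> b <= y) -> b <= inf interval_ratios).
Proof.
apply (inf_spec _ 0 (chi 6 1.7 / (sqrt 1.7 - 1) ^ 2)).
- intros y (a & Ha & ->).
  apply Rdiv_le_0_compat; [|apply sqrt_sub_1_pos; lra].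
  apply chi_spec; [lra|].
  intros f Hf Hf0 _. rewrite <- Hf0. now apply Cn_value_gap.
- exists 1.7. split; [lra|reflexivity].
Qed.

(** [f] itself competes in [chi 6 a] at [a = f 1]. *)
Lemma interval_inf_le_v (f : nat -> R) : Cn 6 f -> f 0%nat = 1 ->
  1.6456659 <= f 1%nat <= 1.8231801 -> inf interval_ratios <= v 6 f.
Proof.
intros Hf Hf0 Ha. rewrite v_normalised by exact Hf0.
apply Rle_trans with (chi 6 (f 1%nat) / (sqrt (f 1%nat) - 1) ^ 2).
- apply interval_ratios_inf. now exists (f 1%nat).
- apply Rmult_le_compat_r.
  + apply Rlt_le, Rinv_0_lt_compat, sqrt_sub_1_pos. lra.
  + apply chi_spec; trivial. lra.
Qed.

Lemma Cn_normalise (n : nat) (f : nat -> R) : Cn n f ->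
  exists g, Cn n g /\ g 0%nat = 1 /\ g 1%nat = f 1%nat / f 0%nat /\ v n g = v n f.
Proof.
intros Hf. assert (H0 : 0 < f 0%nat) by apply Hf.
assert (Hc : 0 < / f 0%nat) by (apply Rinv_0_lt_compat, H0).
exists (fun k => / f 0%nat * f k).
split; [now apply Cn_scale|]. split; [field; lra|]. split; [|now apply v_scale].
unfold Rdiv. ring.
Qed.

Theorem theorem6p1 :
  V 6 = inf (fun y => exists a : R, 1.6456659 <= a <= 1.8231801 /\
                        y = chi 6 a / (sqrt a - 1) ^ 2).
Proof.
change (V 6 = inf interval_ratios). apply Rle_antisym.
- apply interval_ratios_inf. intros y (a & Ha & ->).
  assert (Hs : 0 < (sqrt a - 1) ^ 2) by (apply sqrt_sub_1_pos; lra).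
  apply Rle_div_r; [exact Hs|].
  apply chi_spec; [lra|]. intros f Hf Hf0 <-.
  apply Rle_div_r; [exact Hs|].
  rewrite <- v_normalised by exact Hf0. now apply V_le_v.
(* Once the right-hand side is at most 35, polynomials outside the interval cannot go below it. *)
- assert (Hw : inf interval_ratios <= 35).
  { apply Rle_trans with (2 := v_witness).
    destruct (Cn_normalise 6 witness Cn_witness) as (g & Hg & Hg0 & Hg1 & <-).
    apply interval_inf_le_v; trivial. rewrite Hg1.
    unfold witness, truncated. simpl. lra. }
  apply (inf_spec (fun y => exists f, Cn 6 f /\ y = v 6 f) 0 (v 6 witness)).
  + intros y (f & Hf & ->). now apply v_nonneg.
  + exists witness. split; [apply Cn_witness|reflexivity].
  + intros y (f & Hf & ->).
    destruct (Cn_normalise 6 f Hf) as (g & Hg & Hg0 & _ & <-).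
    destruct (Rle_or_lt 1.6456659 (g 1%nat)) as [H1|H1];
      [destruct (Rle_or_lt (g 1%nat) 1.8231801) as [H2|H2]|].
    * now apply interval_inf_le_v.
    * apply Rle_trans with (1 := Hw). apply v_outside; auto.
    * apply Rle_trans with (1 := Hw). apply v_outside; auto.
Qed.
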